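(* Let $3\le n\le\infty$, let $X,Y$ be dendrites homeomorphic to $D_n$, and let $c$ and $d$ be kaleidoscopic colorings of $X$ and $Y$, respectively. Then there exists a homeomorphism $h\colon X\to Y$ such that $d\circ h=c$ (where $h$ is considered as the induced map $\widehat{X}\to\widehat{Y}$). Furthermore, let $e_0,e_1\in X$ be distinct end points and likewise let $f_0,f_1\in Y$ be distinct end points. Let $x\in[e_0,e_1]$ and $y\in[f_0,f_1]$ be branch points (of $X$ and $Y$ respectively) with $c_x(e_i)=d_y(f_i)$ for $i=0,1$. Then $h$ can be chosen such that $h(e_i)=f_i$ for $i=0,1$ and such that $h(x)=y$.
   Context: A dendrite is a locally connected continuum (non-empty compact connected metrizable space) containing no simple closed curve. Any two distinct points $x,y$ of a dendrite $X$ are joined by a unique arc $[x,y]$; put $(x,y)=[x,y]\setminus\{x,y\}$. For $x\in X$, $\widehat{x}=\pi_0(X\setminus\{x\})$ is the (at most countable) set of components of $X\setminus\{x\}$; $x$ is an end point if $|\widehat{x}|=1$ and a branch point if $|\widehat{x}|\ge 3$; $\mathrm{Br}(X)$ is the (at most countable) set of branch points. For $3\le n\le\infty$ ($\infty$ meaning countably infinite), the Ważewski dendrite $D_n$ is the dendrite, unique up to homeomorphism, which is not a single point, in which $|\widehat{x}|=n$ for every branch point $x$, and in which $(x,y)$ contains a branch point for all $x\ne y$. Write $[n]=\{m\in\mathbf{N}: m<n\}$ (so $[\infty]=\mathbf{N}\ni 0$). For $X$ homeomorphic to $D_n$, a coloring of $X$ is a map $c$ from $\widehat{X}=\bigsqcup_{x\in\mathrm{Br}(X)}\widehat{x}$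 to $[n]$ whose restriction $c|_{\widehat{x}}$ is a bijection $\widehat{x}\to[n]$ for each $x\in \mathrm{Br}(X)$; for $z\ne x$, $c_x(z)$ denotes the color of the component of $X\setminus\{x\}$ containing $z$. The coloring is kaleidoscopic if for all distinct $x,y\in\mathrm{Br}(X)$ and all distinct $i,j\in[n]$ there is $z\in(x,y)\cap\mathrm{Br}(X)$ with $c_z(x)=i$ and $c_z(y)=j$. *)

(* Defs.v *)
From HB Require Import structures.
From mathcomp Require Import all_boot all_order all_algebra.
From mathcomp Require Import all_classical all_reals all_analysis.

Set Implicit Arguments.
Unset Strict Implicit.
Unset Printing Implicit Defensive.

Import Order.TTheory GRing.Theory Num.Theory.
Import numFieldNormedType.Exports.

Local Open Scope classical_set_scope.
Local Open Scope ring_scope.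
Local Open Scope card_scope.

Definition homeomorphism (T U : topologicalType) (h : T -> U) : Prop :=
  exists g : U -> T,
    [/\ cancel h g, cancel g h, continuous h & continuous g].

(* [f] restricts to a homeomorphism between the subspaces [A] and [B]; the
   values of [f] outside [A] (and of [g] outside [B]) play no role. *)
Definition homeo_on (T U : topologicalType) (A : set T) (B : set U)
    (f : T -> U) : Prop :=
  exists g : U -> T,
    [/\ set_fun A B f, set_fun B A g, {in A, cancel f g}, {in B, cancel g f}
      & {within A, continuous f} /\ {within B, continuous g}].

Definition metrizable (R : realType) (T : topologicalType) : Prop :=
  exists (M : metricType R) (f : T -> M), homeomorphism f.

Definition locally_connected (T : topologicalType) : Prop :=
  forall (x : T) (U : set T), nbhs x U ->
    exists V : set T, [/\ open V, V x, V `<=` U & connected V].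

Definition continuum (R : realType) (T : topologicalType) : Prop :=
  [/\ [set: T] !=set0, compact [set: T], connected [set: T] & metrizable R T].

Definition unit_circle (R : realType) : set (R * R) :=
  [set p | p.1 ^+ 2 + p.2 ^+ 2 = 1].

Definition simple_closed_curve (R : realType) (T : topologicalType)
    (C : set T) : Prop :=
  exists f : R * R -> T, homeo_on (@unit_circle R) C f.

Definition dendrite (R : realType) (T : topologicalType) : Prop :=
  [/\ continuum R T, locally_connected T
    & forall C : set T, ~ simple_closed_curve R C].

Definition arc_between (R : realType) (T : topologicalType) (x y : T)
    (A : set T) : Prop :=
  exists f : R -> T, [/\ homeo_on (`[0, 1]%classic : set R) A f, f 0 = x & f 1 = y].

(* In a dendrite there is exactly one arc between distinct points, and [xget]
   selects it. *)
Definition the_arc (R : realType) (T : topologicalType) (x y : T) : set T :=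
  xget set0 [set A | arc_between R x y A].

Definition open_arc (R : realType) (T : topologicalType) (x y : T) : set T :=
  the_arc R x y `\` [set x; y].

Definition component_at (T : topologicalType) (x z : T) : set T :=
  connected_component (~` [set x]) z.

(* The set of components of the complement of [x]. *)
Definition hat (T : topologicalType) (x : T) : set (set T) :=
  component_at x @` (~` [set x]).

Definition end_point (T : topologicalType) (x : T) : Prop := hat x #= `I_1.

Definition branch_point (T : topologicalType) (x : T) : Prop :=
  `I_3 #<= hat x.

(* A value [n : option nat] stands for an element of N or, for [None],
   countable infinity. *)
Definition ge3 (n : option nat) : Prop :=
  if n is Some m then (3 <= m)%N else True.

Definition colors (n : option nat) : set nat :=
  if n is Some m then `I_m else setT.

(* Since the Wazewski dendrite D_n is characterized up to homeomorphism by
   these properties, this says that [T] is homeomorphic to D_n. *)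
Definition wazewski (R : realType) (n : option nat) (T : topologicalType)
    : Prop :=
  [/\ dendrite R T,
      forall x : T, [set: T] <> [set x],
      forall x : T, branch_point x -> hat x #= colors n
    & forall x y : T, x <> y -> exists z, open_arc R x y z /\ branch_point z].

(* A map on the disjoint union of the sets [hat x], [x] a branch point, is
   encoded as a curried total function; its values at [x] and [C] are relevant
   only if [x] is a branch point and [C] is in [hat x]. *)
Definition coloring (n : option nat) (T : topologicalType)
    (c : T -> set T -> nat) : Prop :=
  forall x : T, branch_point x -> set_bij (hat x) (colors n) (c x).

Definition color_of (T : topologicalType) (c : T -> set T -> nat) (x z : T)
    : nat :=
  c x (component_at x z).

Definition kaleidoscopic (R : realType) (n : option nat) (T : topologicalType)
    (c : T -> set T -> nat) : Prop :=
  coloring n c /\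
  forall (x y : T) (i j : nat), branch_point x -> branch_point y -> x <> y ->
    colors n i -> colors n j -> i <> j ->
    exists z, [/\ open_arc R x y z, branch_point z,
                  color_of c z x = i & color_of c z y = j].

(* The equality d o h = c: a homeomorphism [h] maps the component [C] of the
   complement of [x] onto the component [h @` C] of the complement of [h x]. *)
Definition preserves_colors (T U : topologicalType) (c : T -> set T -> nat)
    (d : U -> set U -> nat) (h : T -> U) : Prop :=
  forall (x : T) (C : set T), branch_point x -> hat x C ->
    d (h x) (h @` C) = c x C.

(* Main.v *)
(**
  Write [C z x y] when [x] and [y] lie in the same component of the complement
  of [z]; thus [~ C z x y] says that [z] lies on [[x, y]]. The relation [C]
  alone determines betweenness and medians, and a kaleidoscopic coloring makes
  the branch points homogeneous: a finite color-preserving bijection whose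
  domain is closed under medians extends to any further branch point [p], since
  [p] either separates two points of the domain or hangs off the domain at a
  single point, and in both cases the required colors occur in the other
  dendrite. There are countably many branch points, so back and forth yields a
  color-preserving bijection [P] between all of them. Branch points are dense
  and separate points, so the pairs [(x, y)] that every [(b, b')] in [P] sees in
  the same color form the graph of a homeomorphism.

  That distinct points are separated by a branch point, and hence that interior
  points of arcs separate their ends, follows from the kaleidoscopic condition.
*)
Require Import Defs.
From HB Require Import structures.
From mathcomp Require Import all_boot all_order all_algebra.
From mathcomp Require Import all_classical all_reals all_analysis.

Import Order.TTheory GRing.Theory Num.Theory.
Import numFieldNormedType.Exports.

Set Implicit Arguments.
Unset Strict Implicit.
Unset Printing Implicit Defensive.

(** * Betweenness and colors, axiomatically *)

(** The last clause mentions no arc, since [i <> j] already forces [z] to separate [x] from [y].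
    These may be any two distinct points, not only branch points. *)
Record kaleidoscopic_pretree (n : option nat) (T : Type)
    (C : T -> T -> T -> Prop) (br : T -> Prop) (col : T -> T -> nat) : Prop := {
  pretree_refl : forall z x, x <> z -> C z x x;
  pretree_irr : forall z x, ~ C z z x;
  pretree_sym : forall z x y, C z x y -> C z y x;
  pretree_trans : forall z y x t, C z x y -> C z y t -> C z x t;
  pretree_or : forall w z x, w <> z -> C z x w \/ C w x z;
  pretree_median : forall a b p, exists m,
    [/\ ~ C m a b, ~ C m b p, ~ C m a p & [\/ m = a, m = b, m = p | br m]];
  pretree_col : forall z x y, br z -> x <> z -> y <> z ->
    col z x = col z y <-> C z x y;
  pretree_col_range : forall z x, br z -> x <> z -> colors n (col z x);
  pretree_col_surj : forall z i, br z -> colors n i ->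
    exists2 x, x <> z & col z x = i;
  pretree_kaleidoscopic : forall x y i j, x <> y -> colors n i -> colors n j ->
    i <> j ->
    exists z, [/\ br z, x <> z, y <> z, col z x = i & col z y = j] }.

Section Pretree.
Variables (n : option nat) (T : Type) (C : T -> T -> T -> Prop).
Variables (br : T -> Prop) (col : T -> T -> nat).
Hypothesis HT : kaleidoscopic_pretree n C br col.

Let sym := pretree_sym HT.
Let trans := pretree_trans HT.

Lemma pretree_irrr z x : ~ C z x z.
Proof. by move=> /sym; apply: (pretree_irr HT). Qed.

Lemma pretree_away w z x : w <> z -> ~ C w x z -> C z x w.
Proof. by move=> wz; case: (pretree_or HT x wz). Qed.

Lemma pretree_neql z x y : C z x y -> x <> z.
Proof. by move=> h e; move: h; rewrite e; apply: (pretree_irr HT). Qed.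

(** If [m <> m'], each of [a], [b], [p] lies with [m] as seen from [m'] or with [m'] as seen from
    [m]. Two of the three fall into the same case, so [m] or [m'] fails to separate them. *)
Lemma pretree_median_unique a b p m m' :
  ~ C m a b -> ~ C m b p -> ~ C m a p ->
  ~ C m' a b -> ~ C m' b p -> ~ C m' a p -> m = m'.
Proof.
move=> h1 h2 h3 h1' h2' h3'; apply: contrapT => mm'.
have o x : C m' x m \/ C m x m' by apply: (pretree_or HT).
have [ha|ha] := o a; have [hb|hb] := o b; have [hp|hp] := o p.
all: by [ apply: h1'; apply: trans ha (sym hb) | apply: h1; apply: trans ha (sym hb)
  | apply: h2'; apply: trans hb (sym hp) | apply: h2; apply: trans hb (sym hp)
  | apply: h3'; apply: trans ha (sym hp) | apply: h3; apply: trans ha (sym hp)].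
Qed.

(** If [m <> a], then seen from [a], [m] lies on the side of [p] and not on that of [w]; hence seen
    from [m], [w] lies with [a], away from [p]. *)
Lemma pretree_between_trans m a p w : ~ C m p a -> ~ C a p w -> ~ C m p w.
Proof.
move=> mpa apw mpw.
have [e|ma] := pselect (m = a); first by apply: apw; rewrite -e.
have apm := pretree_away ma mpa.
have [h|h] := pretree_or HT w ma.
  by apply: apw; apply: trans apm (sym h).
by apply: mpa; apply: trans mpw h.
Qed.

(** Since [p] separates [b] from [a] and [v], replacing [b] by [p] does not change the median: [m]
    is also the median of [a], [v], [p]. *)
Lemma pretree_median_side p a v b m :
  C p a v -> ~ C p a b -> m <> p -> ~ C m a v -> ~ C m v b -> ~ C m a b ->
  [/\ C p a m, ~ C m p a & ~ C m p v].
Proof.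
move=> av ab mp mav mvb mab.
have am : C p a m.
  have [//|map] := pretree_or HT a mp.
  have [vm|mvp] := pretree_or HT v mp; first exact: trans av vm.
  by case: mav; apply: trans map (sym mvp).
have mbp : C m b p.
  have [bm|//] := pretree_or HT b mp.
  by case: ab; apply: trans am (sym bm).
split=> // [mpa|mpv].
  by apply: mab; apply: sym; apply: trans mbp mpa.
by apply: mvb; apply: sym; apply: trans mbp mpv.
Qed.

End Pretree.

(** * One-point extensions of finite color-preserving bijections *)

Section PartialIso.
Variables (n : option nat) (X Y : eqType).
Variables (CX : X -> X -> X -> Prop) (CY : Y -> Y -> Y -> Prop).
Variables (brX : X -> Prop) (brY : Y -> Prop).
Variables (colX : X -> X -> nat) (colY : Y -> Y -> nat).

Definition pretree_end (T : Type) (C : T -> T -> T -> Prop) (z : T) :=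
  forall x y, x <> z -> y <> z -> C z x y.

Definition median_in (T : Type) (C : T -> T -> T -> Prop) (A : T -> Prop)
    (a b p : T) :=
  exists2 m, A m & [/\ ~ C m a b, ~ C m b p & ~ C m a p].

Definition dom (s : seq (X * Y)) (x : X) := exists2 p, p \in s & p.1 = x.

Record partial_iso (s : seq (X * Y)) : Prop := {
  piso_inj : {in s &, forall p q, p.1 = q.1 <-> p.2 = q.2};
  piso_type : {in s, forall p, (brX p.1 /\ brY p.2) \/
    (pretree_end CX p.1 /\ pretree_end CY p.2)};
  piso_col : {in s &, forall p q, brX p.1 -> brY p.2 -> q.1 <> p.1 ->
    colX p.1 q.1 = colY p.2 q.2};
  piso_median : {in s & &, forall p q r, median_in CX (dom s) p.1 q.1 r.1};
  piso_br : exists2 p, p \in s & brX p.1 /\ brY p.2 }.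

Hypothesis HX : kaleidoscopic_pretree n CX brX colX.
Hypothesis HY : kaleidoscopic_pretree n CY brY colY.

Lemma median_in_sym (T : Type) (C : T -> T -> T -> Prop) br col A a b p :
  kaleidoscopic_pretree n C br col ->
  median_in C A a b p -> median_in C A b a p /\ median_in C A a p b.
Proof.
move=> H [m Am [h1 h2 h3]].
by split; exists m => //; split=> // /(pretree_sym H).
Qed.

(** At a branch point the colors tell the components apart; at an end point there is only one
    component. *)
Lemma piso_C s p q r : partial_iso s -> p \in s -> q \in s -> r \in s ->
  CX p.1 q.1 r.1 <-> CY p.2 q.2 r.2.
Proof.
move=> H ps qs rs.
have [e|qp] := pselect (q.1 = p.1).
  have e2 := (piso_inj H qs ps).1 e; rewrite e e2.
  by split=> h; [case: (pretree_irr HX h)|case: (pretree_irr HY h)].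
have [e|rp] := pselect (r.1 = p.1).
  have e2 := (piso_inj H rs ps).1 e; rewrite e e2.
  by split=> h; [case: (pretree_irrr HX h)|case: (pretree_irrr HY h)].
have qp2 : q.2 <> p.2 by move=> /(piso_inj H qs ps).
have rp2 : r.2 <> p.2 by move=> /(piso_inj H rs ps).
have [[bx bY]|[ex ey]] := piso_type H ps; last by split=> _; [apply: ey|apply: ex].
rewrite -(pretree_col HX) // -(pretree_col HY) //.
by rewrite (piso_col H ps qs) // (piso_col H ps rs).
Qed.

(** If [p] separates [u] from [v], then [p] itself is the median of [p], [u], [v]; so only pairs on
    one side of [p] need a median in the old domain. *)
Lemma piso_cons s p p' : partial_iso s -> brX p -> brY p' ->
  (forall u, u \in s -> [/\ u.1 <> p, u.2 <> p', colX p u.1 = colY p' u.2 &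
     brX u.1 -> brY u.2 -> colX u.1 p = colY u.2 p']) ->
  (forall u v, u \in s -> v \in s -> CX p u.1 v.1 ->
     median_in CX (dom s) p u.1 v.1) ->
  partial_iso ((p, p') :: s).
Proof.
move=> H bp bp' hu hm.
have dW x : dom s x -> dom ((p, p') :: s) x.
  by move=> [q qs <-]; exists q => //; rewrite inE qs orbT.
have dp : dom ((p, p') :: s) p by exists (p, p') => //; rewrite inE eqxx.
have mW a b c : median_in CX (dom s) a b c -> median_in CX (dom ((p, p') :: s)) a b c.
  by case=> m /dW dm h; exists m.
have mp u v : u \in s -> v \in s -> median_in CX (dom ((p, p') :: s)) p u.1 v.1.
  move=> us vs; have [h|h] := pselect (CX p u.1 v.1); first exact/mW/hm.
  by exists p => //; split=> //; apply: (pretree_irr HX).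
have mpp v : median_in CX (dom ((p, p') :: s)) p p v.
  by exists p => //; split; apply: (pretree_irr HX).
split.
- move=> q r; rewrite !inE => /predU1P[->|qs] /predU1P[->|rs] //=.
  + by have [h1 h2 _ _] := hu _ rs; split=> e; [case: h1|case: h2].
  + by have [h1 h2 _ _] := hu _ qs; split=> e; [case: h1|case: h2].
  + exact: (piso_inj H).
- by move=> q; rewrite !inE => /predU1P[->|qs] /=; [left|apply: (piso_type H)].
- move=> q r; rewrite !inE => /predU1P[->|qs] /predU1P[->|rs] //=.
  + by have [_ _ h _] := hu _ rs.
  + by have [_ _ _ h] := hu _ qs; move=> bx bY _; apply: h.
  + exact: (piso_col H).
- move=> q r t; rewrite !inE.
  move=> /predU1P[->|qs] /predU1P[->|rs] /predU1P[->|ts] //=.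
  + exact: (median_in_sym HX (mpp _)).2.
  + exact: mp.
  + exact: (median_in_sym HX (median_in_sym HX (mpp _)).2).1.
  + exact: (median_in_sym HX (mp _ _ _ _)).1.
  + exact: (median_in_sym HX (median_in_sym HX (mp _ _ _ _)).1).2.
  + exact/mW/(piso_median H).
- by exists (p, p') => //; rewrite inE eqxx.
Qed.

(** On the side of [a0], every domain point is seen from [p] through the gate [a]. Going through the
    domain, the candidate is replaced by its median with [v] and [b], which lies in the domain; as
    [b] is on another side of [p], this is also its median with [v] and [p]. *)
Lemma piso_gate s p a0 b : partial_iso s -> ~ dom s p -> a0 \in s -> b \in s ->
  a0.1 <> p -> ~ CX p a0.1 b.1 ->
  exists a, [/\ a \in s, CX p a0.1 a.1 &
    forall u, u \in s -> CX p a.1 u.1 -> ~ CX a.1 p u.1].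
Proof.
move=> H dp as0 bs a0p ab.
suff hs : forall s' : seq (X * Y), {subset s' <= s} ->
    exists a, [/\ a \in s, CX p a0.1 a.1 &
      forall u, u \in s' -> CX p a.1 u.1 -> ~ CX a.1 p u.1].
  exact: hs.
elim=> [|v s' IH] ss'.
  by exists a0; split=> //; apply: (pretree_refl HX).
have [u us'|a [as_ a0a ga]] := IH; first by apply: ss'; rewrite inE us' orbT.
have [av|nav] := pselect (CX p a.1 v.1); last first.
  by exists a; split=> // u; rewrite inE => /predU1P[->|us']; last exact: ga.
have vs : v \in s by apply: ss'; rewrite inE eqxx.
have [_ [m ms <-] [mav mvb mab]] := piso_median H as_ vs bs.
have mp : m.1 <> p by move=> mp; apply: dp; exists m.
have nab : ~ CX p a.1 b.1.
  by move=> h; apply: ab; apply: (pretree_trans HX) a0a h.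
have [am mpa mpv] := pretree_median_side HX av nab mp mav mvb mab.
exists m; split=> //; first exact: (pretree_trans HX) a0a am.
move=> u; rewrite inE => /predU1P[->//|us'] mu.
apply: (pretree_between_trans HX mpa); apply: ga => //.
exact: (pretree_trans HX) am mu.
Qed.

(** With gates [a] and [b] on two sides of [p], the kaleidoscopic condition yields a [p'] between
    their images that sees them in the colors in which [p] sees [a] and [b]. *)
Lemma piso_ext_between s p a0 b0 : partial_iso s -> brX p -> ~ dom s p ->
  a0 \in s -> b0 \in s -> ~ CX p a0.1 b0.1 ->
  exists p', partial_iso ((p, p') :: s).
Proof.
move=> H bp dp as0 bs0 ab0.
have fresh u : u \in s -> u.1 <> p by move=> us e; apply: dp; exists u.
have [a [as_ a0a ga]] := piso_gate H dp as0 bs0 (fresh _ as0) ab0.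
have ba0 : ~ CX p b0.1 a0.1 by move=> /(pretree_sym HX).
have [b [bs b0b gb]] := piso_gate H dp bs0 as0 (fresh _ bs0) ba0.
have nab : ~ CX p a.1 b.1.
  move=> h; apply: ab0; apply: (pretree_trans HX) a0a _.
  by apply: (pretree_trans HX) h (pretree_sym HX b0b).
have ab1 : a.1 <> b.1.
  by move=> e; apply: nab; rewrite e; apply/(pretree_refl HX)/fresh.
have ab2 : a.2 <> b.2 by move=> /(piso_inj H as_ bs).
have cab : colX p a.1 <> colX p b.1.
  by move=> /(pretree_col HX bp (fresh _ as_) (fresh _ bs)).
have [p' [bp' ap' bp'' ca cb]] := pretree_kaleidoscopic HY ab2
  (pretree_col_range HX bp (fresh _ as_)) (pretree_col_range HX bp (fresh _ bs)) cab.
have nab' : ~ CY p' a.2 b.2.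
  by rewrite -(pretree_col HY) // ca cb.
(* [p'] inherits the side of [p] on which each point of the domain lies. *)
have main e f : e \in s -> f \in s -> ~ CX p e.1 f.1 -> ~ CY p' e.2 f.2 ->
    e.2 <> p' -> f.2 <> p' -> colX p e.1 = colY p' e.2 ->
    (forall u, u \in s -> CX p e.1 u.1 -> ~ CX e.1 p u.1) ->
    forall u, u \in s -> CX p e.1 u.1 ->
    [/\ u.2 <> p', colX p u.1 = colY p' u.2 &
     brX u.1 -> brY u.2 -> colX u.1 p = colY u.2 p'].
  move=> es fs nef nef' ep' fp' ce ge u us eu.
  (* From [e.1], [p] is seen in the direction of [f.1], and likewise [p'] on the other side; so [f]
     stands in for the new pair, to which [piso_C] does not yet apply. *)
  have epf : CX e.1 p f.1.
    apply: (pretree_sym HX); apply: (pretree_away HX); first exact/nesym/fresh.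
    by move=> /(pretree_sym HX).
  have epf' : CY e.2 p' f.2.
    apply: (pretree_sym HY); apply: (pretree_away HY); first exact/nesym.
    by move=> /(pretree_sym HY).
  have nepu := ge u us eu.
  have nepu' : ~ CY e.2 p' u.2.
    move=> h; apply: nepu; apply: (pretree_trans HX) epf _.
    by rewrite (piso_C H) //; apply: (pretree_trans HY) h; apply: (pretree_sym HY).
  have pue : CY p' u.2 e.2.
    apply: (pretree_away HY) => // /(pretree_sym HY); exact.
  have up' := pretree_neql HY pue.
  split=> //.
    have -> : colX p u.1 = colX p e.1.
      by apply/(pretree_col HX) => //; [exact: fresh|exact: fresh|exact: (pretree_sym HX)].
    by rewrite ce; apply/(pretree_col HY) => //; exact: (pretree_sym HY).
  move=> bu bu'.
  have [ue|ue] := pselect (u.1 = e.1).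
    have ue2 := (piso_inj H us es).1 ue.
    have fe : f.1 <> e.1 by exact: (pretree_neql HX (pretree_sym HX epf)).
    rewrite ue ue2 in bu bu' *.
    rewrite ((pretree_col HX _ _ _).2 epf) // ?(piso_col H es fs) //.
    + apply/esym/(pretree_col HY) => //; [exact/nesym|].
      by move=> /(piso_inj H fs es).
    + exact/nesym/fresh.
  have ue2 : u.2 <> e.2 by move=> /(piso_inj H us es).
  have h : CX u.1 p e.1.
    apply: (pretree_away HX) => [/esym//|h].
    exact: nepu.
  have h' : CY u.2 p' e.2.
    by apply: (pretree_away HY) => // /esym.
  rewrite ((pretree_col HX _ _ _).2 h) //; last 2 first.
  - exact/nesym/fresh.
  - exact/nesym.
  rewrite (piso_col H us es) //; last exact/nesym.
  by apply/esym/(pretree_col HY) => //; exact/nesym.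
(* Were [u] on neither side, [p] would be the median of [a], [b], [u], which lies in the domain. *)
have sides u : u \in s -> CX p a.1 u.1 \/ CX p b.1 u.1.
  move=> us; apply: contrapT => /not_orP[nau nbu].
  have [_ [m ms <-] [h1 h2 h3]] := piso_median H as_ bs us.
  by apply: (fresh _ ms); apply: (pretree_median_unique HX h1 h2 h3).
have nba : ~ CX p b.1 a.1 by move=> /(pretree_sym HX).
have nba' : ~ CY p' b.2 a.2 by move=> /(pretree_sym HY).
exists p'; apply: piso_cons => // [u us|u v us vs uv].
  have [h|h] := sides _ us; split; first exact: fresh.
  1-3: by have [] := main a b as_ bs nab nab' ap' bp'' (esym ca) ga u us h.
  exact: fresh.
  1-3: by have [] := main b a bs as_ nba nba' bp'' ap' (esym cb) gb u us h.
(* With [f] across [p], the median of [u], [v], [f] is also that of [p], [u], [v]. *)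
have [f fs nuf] : exists2 f, f \in s & ~ CX p u.1 f.1.
  have [h|h] := sides _ us; [exists b => //|exists a => //] => h'.
    by apply: nab; apply: (pretree_trans HX) h h'.
  by apply: nba; apply: (pretree_trans HX) h h'.
have [_ [m ms <-] [h1 h2 h3]] := piso_median H us vs fs.
have [_ k1 k2] := pretree_median_side HX uv nuf (fresh _ ms) h1 h2 h3.
by exists m.1; [exists m|split].
Qed.

Lemma colors_other j : ge3 n -> exists2 k, colors n k & k <> j.
Proof.
move=> n3; exists (if j == 0 then 1 else 0).
  by case: n n3 => [m|] //= m3; case: ifP => _; apply: leq_trans m3.
by case: eqP => [->|/nesym].
Qed.

(** Two colors have to match, that of [p] at [a] and that of [a] at [p]. The first is met by going
    from [a.2] towards some [q] in the component of that color, the second by a suitable choice of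
    [p'] between [a.2] and [q]. *)
Lemma piso_ext_leaf s p a : ge3 n -> partial_iso s -> brX p -> ~ dom s p ->
  a \in s -> (forall u, u \in s -> ~ CX a.1 p u.1) ->
  exists p', partial_iso ((p, p') :: s).
Proof.
move=> n3 H bp dp as_ ha.
have fresh u : u \in s -> u.1 <> p by move=> us e; apply: dp; exists u.
(* An end point cannot separate [p] from the branch point given by [piso_br]. *)
have [ba ba'] : brX a.1 /\ brY a.2.
  have [//|[ea _]] := piso_type H as_.
  have [u us bu] := piso_br H.
  have [e|e] := pselect (u.1 = a.1).
    by rewrite -e -((piso_inj H us as_).1 e).
  by case: (ha u us); apply: ea => //; exact/nesym/fresh.
have pa : p <> a.1 by exact/nesym/fresh.
have [q qa cq] := pretree_col_surj HY ba' (pretree_col_range HX ba pa).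
have jn := pretree_col_range HX bp (nesym pa).
(* [p'] has to see [q] in another color than [a.2]; any such [k] will do. *)
have [k kn kj] := colors_other (colX p a.1) n3.
have [p' [bp' ap' qp' ca ck]] :=
  pretree_kaleidoscopic HY (nesym qa) jn kn (nesym kj).
have qap : CY a.2 q p'.
  apply: (pretree_away HY); first exact: nesym.
  move=> /(pretree_sym HY); rewrite -(pretree_col HY) // ca ck.
  exact/nesym.
have cap : colY a.2 p' = colX a.1 p.
  by rewrite -cq; apply/(pretree_col HY) => //; [exact: nesym|exact: (pretree_sym HY)].
have ha' u : u \in s -> ~ CY a.2 p' u.2.
  move=> us h; have ua2 := pretree_neql HY (pretree_sym HY h).
  have ua : u.1 <> a.1 by move=> /(piso_inj H us as_).
  apply: (ha u us); rewrite -(pretree_col HX) // (piso_col H as_ us) // -cap.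
  by apply/(pretree_col HY) => //; exact: nesym.
exists p'; apply: piso_cons => // [u us|u v us vs uv].
  have [e|ua] := pselect (u.1 = a.1).
    by rewrite e ((piso_inj H us as_).1 e); split=> //; exact/nesym.
  have ua2 : u.2 <> a.2 by move=> /(piso_inj H us as_).
  have pua : CX p u.1 a.1.
    by apply: (pretree_away HX) => [//|/(pretree_sym HX)]; [exact: nesym|exact: ha].
  have pua' : CY p' u.2 a.2.
    by apply: (pretree_away HY) => [//|/(pretree_sym HY)]; exact: ha'.
  have upa : CX u.1 p a.1 by apply: (pretree_away HX); [exact: nesym|exact: ha].
  have upa' : CY u.2 p' a.2 by apply: (pretree_away HY); [exact: nesym|exact: ha'].
  have up' := pretree_neql HY pua'.
  split=> //; first exact: fresh.
    rewrite ((pretree_col HX _ _ _).2 pua) //; [|exact: fresh|exact: nesym].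
    by rewrite ((pretree_col HY _ _ _).2 pua').
  move=> bu bu'.
  rewrite ((pretree_col HX _ _ _).2 upa) //; [|exact/nesym/fresh|exact: nesym].
  rewrite ((pretree_col HY _ _ _).2 upa') //; [|exact/nesym|exact: nesym].
  by rewrite (piso_col H us as_) //; exact: nesym.
have [_ [m ms <-] [h1 h2 h3]] := piso_median H as_ us vs.
(* Since [p] sees the domain through [a], the median of [a], [u], [v] also serves [p], [u], [v]. *)
have tr w : w \in s -> ~ CX m.1 a.1 w.1 -> ~ CX m.1 p w.1.
  move=> ws h k'; have [e|ma] := pselect (m.1 = a.1).
    by apply: (ha w ws); rewrite -e.
  apply: h; apply: (pretree_trans HX) k'; apply: (pretree_sym HX).
  by apply: (pretree_away HX); [exact: nesym|exact: ha].
by exists m.1; [exists m|split=> //; exact: tr].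
Qed.

(* [g] is the point where the branch containing [p] attaches to the hull of
   the domain. *)
Lemma piso_project s p : partial_iso s ->
  (forall u v, u \in s -> v \in s -> CX p u.1 v.1) ->
  exists g, [/\ exists2 u, u \in s & exists2 v, v \in s & ~ CX g u.1 v.1,
    dom s g \/ brX g & forall u, u \in s -> ~ CX g p u.1].
Proof.
move=> H hp.
suff hs : forall s' : seq (X * Y), {subset s' <= s} -> exists g,
   [/\ exists2 u, u \in s & exists2 v, v \in s & ~ CX g u.1 v.1,
    dom s g \/ brX g & forall u, u \in s' -> ~ CX g p u.1].
  exact: hs.
elim=> [|v s' IH] ss'.
  have [u us _] := piso_br H; exists u.1; split=> //; last by left; exists u.
  by exists u => //; exists u => //; apply: (pretree_irr HX).
have [u us'|g [[a as_ [b bs nab]] tg gg]] := IH.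
  by apply: ss'; rewrite inE us' orbT.
have vs : v \in s by apply: ss'; rewrite inE eqxx.
have [m [mpg mgv mpv mt]] := pretree_median HX p g v.1.
(* The new [m] must still separate two domain points. If [m <> g] separated [v] neither from [a] nor
   from [b], then both would lie on the side of [m] as seen from [g], although [g] separates
   them. *)
have mab : exists2 u, u \in s & exists2 v, v \in s & ~ CX m u.1 v.1.
  have [e|mg] := pselect (m = g).
    by exists a => //; exists b => //; rewrite e.
  have [mav|mav] := pselect (CX m a.1 v.1); last by exists a => //; exists v.
  have [mbv|mbv] := pselect (CX m b.1 v.1); last by exists b => //; exists v.
  exfalso; apply: nab; apply: (pretree_trans HX (y := m)).
    apply: (pretree_away HX) => // mag.
    by apply: mgv; apply: (pretree_trans HX) mav; exact: (pretree_sym HX).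
  apply: (pretree_sym HX); apply: (pretree_away HX) => // mbg.
  by apply: mgv; apply: (pretree_trans HX) mbv; exact: (pretree_sym HX).
exists m; split=> //.
  case: mt => [mp|mg|mv|]; last by right.
  - by case: mab => u us [w ws []]; rewrite mp; exact: hp.
  - by rewrite mg.
  - by left; exists v.
move=> u; rewrite inE => /predU1P[->//|us'].
by apply: (pretree_between_trans HX mpg); exact: gg.
Qed.

(** When the point [g] at which [p] hangs off is not in the domain, it separates two domain points
    and is added first; [p] is then attached at [g]. *)
Lemma piso_ext s p : ge3 n -> partial_iso s -> brX p ->
  exists s', [/\ partial_iso s', {subset s <= s'} & dom s' p].
Proof.
move=> n3 H bp.
have [dp|dp] := pselect (dom s p); first by exists s; split=> // x.
have subc q : {subset s <= q :: s} by move=> u us; rewrite inE us orbT.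
have dc q q' (t : seq (X * Y)) : dom ((q, q') :: t) q.
  by exists (q, q') => //; rewrite inE eqxx.
have [[a as_ [b bs ab]]|hp] := pselect (exists2 u, u \in s &
    exists2 v, v \in s & ~ CX p u.1 v.1).
  have [p' H'] := piso_ext_between H bp dp as_ bs ab.
  by exists ((p, p') :: s).
have {}hp u v : u \in s -> v \in s -> CX p u.1 v.1.
  by move=> us vs; apply: contrapT => h; apply: hp; exists u => //; exists v.
have [g [[a as_ [b bs ab]] tg gg]] := piso_project H hp.
have [dg|dg] := pselect (dom s g).
  case: dg => q qs qg; rewrite -qg in gg.
  have [p' H'] := piso_ext_leaf n3 H bp dp qs gg.
  by exists ((p, p') :: s).
have bg : brX g by case: tg.
have [g' H'] := piso_ext_between H bg dg as_ bs ab.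
have pg : p <> g by move=> pg; apply: ab; rewrite -pg; exact: hp.
have dp' : ~ dom ((g, g') :: s) p.
  move=> [u]; rewrite inE => /predU1P[->/= /esym//|us up].
  by apply: dp; exists u.
have [|u|p' H''] := piso_ext_leaf n3 H' bp dp' (a := (g, g')).
- by rewrite inE eqxx.
- rewrite inE => /predU1P[->|us] /=; first exact: (pretree_irrr HX).
  exact: gg.
exists [:: (p, p'), (g, g') & s]; split=> // u us.
by rewrite !inE us !orbT.
Qed.

End PartialIso.

(** By [piso_C] images of medians are medians, so closure under medians passes to the range. *)
Lemma piso_swap n (X Y : eqType) CX CY brX brY colX colY (s : seq (X * Y)) :
  kaleidoscopic_pretree n CX brX colX -> kaleidoscopic_pretree n CY brY colY ->
  partial_iso CX CY brX brY colX colY s ->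
  partial_iso CY CX brY brX colY colX [seq (p.2, p.1) | p <- s].
Proof.
move=> HX HY H; split.
- move=> _ _ /mapP[p ps ->] /mapP[q qs ->] /=.
  by split=> /(piso_inj H ps qs).
- move=> _ /mapP[p ps ->] /=.
  by have [[? ?]|[? ?]] := piso_type H ps; [left|right].
- move=> _ _ /mapP[p ps ->] /mapP[q qs ->] /= bp bp' qp.
  by rewrite (piso_col H ps qs) // => /(piso_inj H qs ps).
- move=> _ _ _ /mapP[p ps ->] /mapP[q qs ->] /mapP[r rs ->] /=.
  have [_ [m ms <-] [h1 h2 h3]] := piso_median H ps qs rs.
  exists m.2; first by exists ((m.2, m.1)) => //; apply/mapP; exists m.
  by split; rewrite /= -(piso_C HX HY H).
- have [p ps [b1 b2]] := piso_br H.
  by exists ((p.2, p.1)) => //; apply/mapP; exists p.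
Qed.

(** * The back-and-forth construction *)

Section BackAndForth.
Variables (n : option nat) (X Y : eqType).
Variables (CX : X -> X -> X -> Prop) (CY : Y -> Y -> Y -> Prop).
Variables (brX : X -> Prop) (brY : Y -> Prop).
Variables (colX : X -> X -> nat) (colY : Y -> Y -> nat).
Hypothesis HX : kaleidoscopic_pretree n CX brX colX.
Hypothesis HY : kaleidoscopic_pretree n CY brY colY.

Let piso := partial_iso CX CY brX brY colX colY.

Lemma piso_back s q : ge3 n -> piso s -> brY q ->
  exists s', [/\ piso s', {subset s <= s'} & exists2 p, p \in s' & p.2 = q].
Proof.
move=> n3 H bq.
have [s' [H' ss' [p ps' pq]]] := piso_ext HY HX n3 (piso_swap HX HY H) bq.
exists [seq (p.2, p.1) | p <- s']; split; first exact: (piso_swap HY HX).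
  move=> [u1 u2] us; apply/mapP; exists (u2, u1) => //.
  by apply/ss'/mapP; exists (u1, u2).
by exists (p.2, p.1) => //; apply/mapP; exists p.
Qed.

(** [P] is the union of an increasing chain of finite stages, the [k]-th step treating [EX k] and
    [EY k] if they are branch points. Two pairs always share a stage, which suffices for properties
    that involve at most two pairs. *)
Lemma back_and_forth s (EX : nat -> X) (EY : nat -> Y) : ge3 n -> piso s ->
  (forall x, brX x -> exists k, EX k = x) ->
  (forall y, brY y -> exists k, EY k = y) ->
  exists P : X -> Y -> Prop,
  [/\ forall p, p \in s -> P p.1 p.2,
      forall x y x' y', P x y -> P x' y' -> exists t, [/\ piso t, (x, y) \in t &
        (x', y') \in t],
      forall x, brX x -> exists y, P x y & forall y, brY y -> exists x, P x y].
Proof.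
move=> n3 Hs eX eY.
have step k (t : {t | piso t}) : exists t' : {t | piso t},
    [/\ {subset sval t <= sval t'},
      brX (EX k) -> exists y, (EX k, y) \in sval t' &
      brY (EY k) -> exists x, (x, EY k) \in sval t'].
  case: t => t Ht.
  have [t1 [H1 s1 d1]] : exists t', [/\ piso t', {subset t <= t'} &
      brX (EX k) -> exists y, (EX k, y) \in t'].
    have [b|nb] := pselect (brX (EX k)); last by exists t; split=> // x.
    have [t' [H' s' [[x y] ps px]]] := piso_ext HX HY n3 Ht b.
    by exists t'; split=> // _; exists y; rewrite -px.
  have [t2 [H2 s2 d2]] : exists t', [/\ piso t', {subset t1 <= t'} &
      brY (EY k) -> exists x, (x, EY k) \in t'].
    have [b|nb] := pselect (brY (EY k)); last by exists t1; split=> // x.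
    have [t' [H' s' [[x y] ps py]]] := piso_back n3 H1 b.
    by exists t'; split=> // _; exists x; rewrite -py.
  exists (exist _ t2 H2); split=> //= [u ut|/d1[y yt]]; first exact/s2/s1.
  by exists y; apply: s2.
have [f hf] := choice (fun kt : nat * {t | piso t} => step kt.1 kt.2).
pose F := fix F k := if k is k'.+1 then f (k', F k') else exist piso s Hs.
have FS k l : (k <= l)%N -> {subset sval (F k) <= sval (F l)}.
  elim: l => [|l IH]; first by rewrite leqn0 => /eqP ->.
  rewrite leq_eqVlt ltnS => /predU1P[-> //|/IH h] u /h ul.
  by have [h1 _ _] := hf (l, F l); apply: h1.
exists (fun x y => exists k, (x, y) \in sval (F k)); split.
- by move=> [x y] ps; exists 0%N.
- move=> x y x' y' [k xy] [l xy'].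
  exists (sval (F (maxn k l))); split; first exact: svalP.
    exact: (FS k _ (leq_maxl _ _)).
  exact: (FS l _ (leq_maxr _ _)).
- move=> x bx; have [k kx] := eX _ bx; rewrite -kx in bx *.
  by have [_ h _] := hf (k, F k); have [y hy] := h bx; exists y, k.+1.
- move=> y bY; have [k ky] := eY _ bY; rewrite -ky in bY *.
  by have [_ _ h] := hf (k, F k); have [x hx] := h bY; exists x, k.+1.
Qed.

End BackAndForth.

(** * Components of point complements, and arcs *)

Section Dendrite.
Variables (R : realType) (T : topologicalType).

Local Open Scope classical_set_scope.
Local Open Scope ring_scope.
Local Open Scope card_scope.

Local Notation C := (@component_at T).
Implicit Types x y z : T.

Lemma component_at_refl z x : x <> z -> C z x x.
Proof. by move=> xz; apply: connected_component_refl. Qed.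

Lemma component_at_neq z x y : C z x y -> y <> z.
Proof. by move=> /connected_component_sub. Qed.

Lemma component_at_sym z x y : C z x y -> C z y x.
Proof. exact: connected_component_sym. Qed.

Lemma component_at_trans z y x t : C z x y -> C z y t -> C z x t.
Proof. exact: connected_component_trans. Qed.

Lemma component_at_connected (A : set T) z x y :
  connected A -> A x -> A y -> ~ A z -> C z x y.
Proof.
move=> cA Ax Ay Az; apply: connected_component_max Ay => //.
by move=> t At tz; apply: Az; rewrite -tz.
Qed.

Lemma component_at_avoid w q v x y :
  C w q x -> C w q y -> ~ C w q v -> C v x y.
Proof. exact/component_at_connected/component_connected. Qed.

(** Trades the cardinality for three points in different components, the form in which medians give
    branch points. *)
Lemma branch_pointP x : branch_point x <-> exists a b p,
  [/\ a <> x, b <> x & p <> x] /\ [/\ ~ C x a b, ~ C x b p & ~ C x a p].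
Proof.
have eqC u v : C x u = C x v -> v <> x -> C x u v.
  by move=> -> vx; apply: component_at_refl.
split.
  move=> /pcard_leP[f].
  have h k : (k < 3)%N -> exists2 a, a <> x & C x a = f k.
    by move=> k3; have [a ax fa] := @funS _ _ _ _ f k k3; exists a.
  have [a ax fa] := h 0%N isT; have [b bx fb] := h 1%N isT.
  have [p px fp] := h 2%N isT.
  have i k l : (k < 3)%N -> (l < 3)%N -> f k = f l -> k = l.
    by move=> k3 l3; apply: (@inj _ _ _ f); rewrite inE.
  exists a, b, p; split=> //; split => /same_connected_component.
  - by rewrite -/(C x a) -/(C x b) fa fb => /i -/(_ isT isT).
  - by rewrite -/(C x p) -/(C x b) fp fb => /i -/(_ isT isT).
  - by rewrite -/(C x a) -/(C x p) fa fp => /i -/(_ isT isT).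
move=> [a [b [p [[ax bx px] [ab bp ap]]]]].
pose f k := C x (nth a [:: a; b; p] k).
have ff : set_fun `I_3 (hat x) f.
  by move=> [|[|[|//]]] _; [exists a|exists b|exists p].
have fi : set_inj `I_3 f.
  move=> [|[|[|k]]] [|[|[|l]]]; rewrite ?inE //= => _ _ /eqC h;
    by [case: ab; apply: h|case: bp; apply: h|case: ap; apply: h|
        case: ab; apply/component_at_sym/h|case: bp; apply/component_at_sym/h|
        case: ap; apply/component_at_sym/h].
rewrite /branch_point -(card_le_eql (inj_card_eq fi)).
by apply: subset_card_le => _ [k k3 <-]; exact: ff.
Qed.

Lemma end_point_component z x y : end_point z -> x <> z -> y <> z -> C z x y.
Proof.
move=> /card_eqPle[/pcard_leP[f] _] xz yz.
have hf u : u <> z -> f (C z u) = 0%N.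
  move=> uz; have : `I_1 (f (C z u)) by apply: (@funS _ _ _ _ f); exists u.
  by rewrite /= ltnS leqn0 => /eqP.
have e : C z x = C z y.
  apply: (@inj _ _ _ f); rewrite ?inE; [by exists x|by exists y|].
  exact: etrans (hf x xz) (esym (hf y yz)).
by rewrite e; exact: component_at_refl.
Qed.

(** Nonemptiness excludes the default value [set0] of [xget], so the selected set is an arc. *)
Lemma arc_param x y : the_arc R x y !=set0 -> exists f : R -> T,
  [/\ f 0 = x, f 1 = y, {in `[0, 1]%classic &, injective f},
    {within `[0, 1]%classic, continuous f} &
    the_arc R x y = f @` `[0, 1]%classic].
Proof.
rewrite /the_arc; case: xgetP => [A -> [f [[g [fA gA fK gK [fc gc]]] f0 f1]] _|_ [z []//]].
exists f; split=> //.
  by move=> s t s01 t01 e; rewrite -(fK s s01) -(fK t t01) e.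
apply/seteqP; split=> [a Aa|_ [t t01 <-]]; last exact: fA.
by exists (g a); [exact: gA|apply: gK; rewrite inE].
Qed.

Lemma arc_connected x y : the_arc R x y !=set0 ->
  [/\ connected (the_arc R x y), the_arc R x y x & the_arc R x y y].
Proof.
move=> /arc_param[f [f0 f1 _ fc ->]]; split.
- apply: connected_continuous_connected fc.
  by apply/connected_intervalP; exact: interval_is_interval.
- by exists 0 => //; rewrite /= in_itv /= lexx ler01.
- by exists 1 => //; rewrite /= in_itv /= lexx ler01.
Qed.

(** The arc is cut at the parameter of [z]; by injectivity the two halves meet only there. *)
Lemma open_arc_cut x y z : open_arc R x y z -> exists A B : set T,
  [/\ connected A, connected B, A x /\ A z, B z /\ B y & A `&` B `<=` [set z]].
Proof.
move=> [az _]; have [f [f0 f1 finj fc afE]] := @arc_param x y (ex_intro _ z az).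
have [t + ft] : exists2 t : R, (0 <= t <= 1) & f t = z.
  by move: az; rewrite afE => -[t]; rewrite /= in_itv; exists t.
move=> /andP[t0 t1].
have s1 : `[0, t]%classic `<=` `[0, 1]%classic.
  by move=> s; rewrite /= !in_itv /= => /andP[-> /le_trans]; apply.
have s2 : `[t, 1]%classic `<=` `[0, 1]%classic.
  by move=> s; rewrite /= !in_itv /= => /andP[/(le_trans t0) -> ->].
have co (a b : R) : `[a, b]%classic `<=` `[0, 1]%classic -> connected (f @` `[a, b]%classic).
  move=> ab; apply: connected_continuous_connected; last exact: continuous_subspaceW fc.
  by apply/connected_intervalP; exact: interval_is_interval.
exists (f @` `[0, t]%classic), (f @` `[t, 1]%classic); split; [exact: co|exact: co| | |].
- by split; [exists 0|exists t] => //; rewrite /= in_itv /= lexx t0.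
- by split; [exists t|exists 1] => //; rewrite /= in_itv /= t1 lexx.
move=> _ [[s s0t <-] [r rt1 rs]].
have : r = s by apply: finj => //; rewrite inE; [exact: s2|exact: s1].
move=> ers; rewrite ers in rt1; rewrite /= -ft; congr f.
move: s0t rt1; rewrite /= !in_itv /= => /andP[_ st] /andP[ts _].
by apply/eqP; rewrite eq_le st ts.
Qed.

(** * Separation and medians in a kaleidoscopic dendrite *)

Variables (n : option nat) (c : T -> set T -> nat).
Hypotheses (n3 : ge3 n) (HW : wazewski R n T) (HK : kaleidoscopic R n c).

Lemma wazewski_compact : compact [set: T].
Proof. by have [[[]]] := HW. Qed.

Lemma wazewski_connected : connected [set: T].
Proof. by have [[[]]] := HW. Qed.

Lemma wazewski_hausdorff : hausdorff_space T.
Proof.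
have [[[_ _ _ [M [f [g [fK gK fc gc]]]]] _ _] _ _ _] := HW.
move=> p q pq; rewrite -(fK p) -(fK q); congr g.
apply: (@metric_hausdorff R M) => A B nA nB.
have [x [Ax Bx]] := pq _ _ (fc p _ nA) (fc q _ nB).
by exists (f x).
Qed.

Lemma wazewski_closed1 z : closed [set z].
Proof.
by apply: accessible_closed_set1; apply: hausdorff_accessible; exact: wazewski_hausdorff.
Qed.

Lemma component_at_open z x : open (C z x).
Proof.
have [[_ lc _] _ _ _] := HW.
rewrite openE => y xy; rewrite /interior nbhsE.
have [V [oV Vy Vz cV]] : exists V : set T,
    [/\ open V, V y, V `<=` ~` [set z] & connected V].
  apply: lc; apply: open_nbhs_nbhs; split.
    exact/closed_openC/wazewski_closed1.
  exact: component_at_neq xy.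
exists V => // t Vt; apply: component_at_trans xy _.
exact: connected_component_max Vt.
Qed.

(** This set is the closure of the component: other components are open, and the component is not
    closed because [T] is connected. *)
Lemma component_atU1_connected z x : x <> z -> connected (C z x `|` [set z]).
Proof.
move=> xz.
have clE : closure (C z x) `<=` C z x `|` [set z].
  move=> y cly; apply: contrapT => /not_orP[nxy yz].
  have [t [xt yt]] := cly _ (open_nbhs_nbhs (conj (component_at_open z y)
    (component_at_refl yz))).
  by apply: nxy; apply: component_at_trans xt (component_at_sym yt).
have zcl : closure (C z x) z.
  apply: contrapT => nz.
  have clC : closed (C z x).
    rewrite closure_id; apply/seteqP; split; first exact: subset_closure.
    by move=> y cly; have [//|yz] := clE _ cly; rewrite yz in cly.
  have e : C z x = [set: T].
    apply: wazewski_connected.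
    - by exists x; exact: component_at_refl.
    - by exists (C z x); [exact: component_at_open|rewrite setTI].
    - by exists (C z x) => //; rewrite setTI.
  have : C z x z by rewrite e.
  by move=> /component_at_neq.
suff -> : C z x `|` [set z] = closure (C z x).
  by apply: connected_closure; exact: component_connected.
by apply/seteqP; split=> // y [|->//]; exact: subset_closure.
Qed.

(** If [w] is outside the component of [x] at [z], that component with [z] added is connected and
    misses [w]. *)
Lemma component_at_or w z x : w <> z -> C z x w \/ C w x z.
Proof.
move=> wz; have [xz|xz] := pselect (x = z).
  by right; rewrite xz; apply: component_at_refl; exact: nesym.
have [h|h] := pselect (C z x w); [by left|right].
apply: component_at_connected (component_atU1_connected xz) _ _ _.
- by left; exact: component_at_refl.
- by right.
- by case.
Qed.

Lemma component_at_away w z x : w <> z -> ~ C w x z -> C z x w.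
Proof. by move=> wz; case: (component_at_or x wz). Qed.

Lemma color_component z x y : branch_point z -> x <> z -> y <> z ->
  color_of c z x = color_of c z y <-> C z x y.
Proof.
move=> bz xz yz; have [_ ci _] := HK.1 z bz; split.
  move=> /ci h; have : C z x = C z y.
    by apply: h; rewrite inE; [exists x|exists y].
  by move=> ->; exact: component_at_refl.
by move=> /same_connected_component e; rewrite /color_of /component_at e.
Qed.

Lemma color_range z x : branch_point z -> x <> z -> colors n (color_of c z x).
Proof. by move=> bz xz; have [cf _ _] := HK.1 z bz; apply: cf; exists x. Qed.

Lemma color_surj z i : branch_point z -> colors n i ->
  exists2 x, x <> z & color_of c z x = i.
Proof.
move=> bz ni; have [_ _ cs] := HK.1 z bz.
by have [_ [x xz <-] <-] := cs i ni; exists x.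
Qed.

Lemma open_arc_neq x y z : open_arc R x y z -> x <> z /\ y <> z.
Proof. by move=> [_ /= /not_orP[/nesym ? /nesym ?]]. Qed.

Lemma branch_arc x y : x <> y -> exists2 z, open_arc R x y z & branch_point z.
Proof. by have [_ _ _ h] := HW => /h[z [? ?]]; exists z. Qed.

Let conjoined x y :=
  forall b, branch_point b -> x <> b -> y <> b -> C b x y.

(** A branch point other than [z] misses one of the two halves of the arc, and that half links [z]
    to [x] or to [y]. *)
Lemma conjoined_sub x y z : conjoined x y -> open_arc R x y z ->
  conjoined x z /\ conjoined z y.
Proof.
move=> xy xzy; have [xz yz] := open_arc_neq xzy.
have [A [B [cA cB [Ax Az] [Bz By] AB]]] := open_arc_cut xzy.
split=> w bw w1 w2; apply: contrapT => h.
  have Aw : A w by apply: contrapT => Aw; apply: h; exact: component_at_connected Aw.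
  have nBw : ~ B w by move=> Bw; apply: w2; exact/esym/AB.
  apply: h; apply: (@component_at_trans _ y); last exact: component_at_connected nBw.
  by apply: xy => // yw; apply: nBw; rewrite -yw.
have Bw : B w by apply: contrapT => Bw; apply: h; exact: component_at_connected Bw.
have nAw : ~ A w by move=> Aw; apply: w1; exact/esym/AB.
apply: h; apply: (@component_at_trans _ x); first exact: component_at_connected nAw.
by apply: xy => // xw; apply: nAw; rewrite -xw.
Qed.

(* Two points not separated by a branch point would give two branch points
   with this property, against the kaleidoscopic condition. *)
Lemma branch_separates x y : x <> y -> exists b,
  [/\ branch_point b, x <> b, y <> b & ~ C b x y].
Proof.
move=> xy; apply: contrapT => h.
have cxy : conjoined x y.
  by move=> b bb xb yb; apply: contrapT => nb; apply: h; exists b.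
have [z xzy bz] := branch_arc xy.
have [xz _] := open_arc_neq xzy; have [cxz _] := conjoined_sub cxy xzy.
have [z' xzz bz'] := branch_arc xz.
have [_ zz'] := open_arc_neq xzz; have [_ czz] := conjoined_sub cxz xzz.
have n0 : colors n 0%N by case: n n3 => //= m; apply: leq_trans.
have [k nk k0] := colors_other 0%N n3.
have [w [zwz bw cw1 cw2]] := HK.2 _ _ _ _ bz' bz (nesym zz') nk n0 k0.
have [zw z'w] := open_arc_neq zwz.
by apply: k0; rewrite -cw1 -cw2; apply/color_component => //; exact: czz.
Qed.

(* [v] cuts [a] and [p] off from [z]. *)
Lemma component_at_cut z a p : C z a p -> exists v,
  [/\ branch_point v, z <> v, C v a p & ~ C v a z].
Proof.
move=> zap.
(* [E] is open, and closed relative to the component of [a] at [z]; by connectedness it contains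
   [p]. *)
pose E := [set q | exists v, [/\ branch_point v, z <> v, C v a q & ~ C v a z]].
have az : a <> z := component_at_neq (component_at_sym zap).
have Ea : E a.
  by have [v [bv av zv nv]] := branch_separates az; exists v; split=> //;
    exact: component_at_refl.
have EW q w : branch_point w -> z <> w -> E q -> q <> w -> ~ C w q z ->
    C w q `<=` E.
  move=> bw zw [v [bv zv aq az']] qw qz r wqr.
  (* If [w] lies with [q] as seen from [v], then [v] still works for [r]; otherwise [w] does. *)
  have [h|h] := pselect (C v q w).
    exists v; split=> //; apply: (component_at_trans aq).
    apply: (component_at_avoid (component_at_refl qw) wqr) => wqv.
    have [h'|h'] := component_at_or z (nesym (component_at_neq h)).
      apply: qz; apply: component_at_trans wqv _.
      exact: component_at_sym.
    by apply: az'; apply: component_at_trans aq _; apply: component_at_trans h _;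
      exact: component_at_sym.
  have waq : C w a q.
    apply: (component_at_avoid (component_at_trans aq (component_at_sym aq)) aq).
    by move=> vaw; apply: h; apply: component_at_trans (component_at_sym aq) vaw.
  exists w; split=> //; first exact: component_at_trans waq wqr.
  by move=> waz; apply: qz; apply: component_at_trans (component_at_sym waq) waz.
have oE : open E.
  have -> : E = \bigcup_(v in [set v | [/\ branch_point v, z <> v & ~ C v a z]]) C v a.
    by apply/seteqP; split=> [q [v [? ? ? ?]]|q [v [? ? ?] ?]]; exists v.
  by apply: bigcup_open => v _; exact: component_at_open.
have oE' : open (C z a `\` E).
  rewrite openE => r [zar nEr]; rewrite /interior nbhsE.
  have rz := component_at_neq zar.
  (* A point of [E] on the side of [r] at this [v] would put [r] into [E] by [EW]. *)
  have [v [bv rv zv nv]] := branch_separates rz.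
  exists (C v r `&` C z a).
    split; last by split=> //; exact: component_at_refl.
    by apply: openI; exact: component_at_open.
  move=> q [vrq zaq]; split=> // Eq; apply: nEr.
  apply: (EW q v) => //.
  - exact: component_at_neq vrq.
  - by move=> vqz; apply: nv; exact: component_at_trans vrq vqz.
  - exact: component_at_sym.
have : C z a `&` E = C z a.
  apply: (@component_connected _ (~` [set z]) a).
  - by exists a; split=> //; exact: component_at_refl.
  - by exists E.
  - exists (~` (C z a `\` E)); first exact: open_closedC.
    apply/seteqP; split=> q [? h]; split=> //; first by case.
    by apply: contrapT => nE; apply: h.
by move=> /seteqP[_ /(_ p zap) []].
Qed.

(** Otherwise some [v] cuts [x] and [y] off from [z]; it lies on both halves of the arc, which meet
    only in [z]. *)
Lemma open_arc_separates x y z : open_arc R x y z -> ~ C z x y.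
Proof.
move=> xzy zxy; have [A [B [cA cB [Ax Az] [Bz By] AB]]] := open_arc_cut xzy.
have [v [bv zv vxy nvxz]] := component_at_cut zxy.
apply: (zv); apply/esym/AB; split; apply: contrapT => h; apply: nvxz.
  exact: component_at_connected h.
by apply: component_at_trans vxy _; exact: component_at_connected h.
Qed.

(* The points cut off from [b] and [p] together, on the side of [a]; such sets
   for [a] and [b] are open and disjoint, so an arc from [a] to [b] leaves
   their union, which yields the median. *)
Let cut_off a b p := [set q | exists v, [/\ C v a q, ~ C v a b & C v b p]].

Lemma cut_off_open a b p : open (cut_off a b p).
Proof.
have -> : cut_off a b p =
    \bigcup_(v in [set v | ~ C v a b /\ C v b p]) C v a.
  by apply/seteqP; split=> [q [v [? ? ?]]|q [v [? ?] ?]]; exists v.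
by apply: bigcup_open => v _; exact: component_at_open.
Qed.

Lemma cut_off_refl a b p : C a b p -> cut_off a b p a.
Proof.
move=> abp; have [v [bv av vbp nvba]] := component_at_cut abp.
exists v; split=> //; first exact: component_at_refl.
by move=> /component_at_sym.
Qed.

(** If [w] lies with [a] as seen from [v], the component of [b] and [p] at [v] misses [w]; otherwise
    the component of [a] and [q] does. Either way [w] fails to separate [a] from [b]. *)
Lemma cut_off_disjoint a b p q : cut_off a b p q -> ~ cut_off b a p q.
Proof.
move=> [v [vaq nvab vbp]] [w [wbq nwba wap]].
have [vaw|nvaw] := pselect (C v a w).
  apply: nwba; apply: component_at_trans (component_at_sym wap).
  apply: (component_at_avoid (component_at_trans vbp (component_at_sym vbp)) vbp).
  by move=> vbw; apply: nvab; apply: component_at_trans vaw (component_at_sym vbw).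
apply: nwba; apply: component_at_trans wbq _.
exact: component_at_avoid vaq (component_at_trans vaq (component_at_sym vaq)) nvaw.
Qed.

(** A point [v] cutting [a] and [p] off from [m] would put [m] into [cut_off b a p]. *)
Lemma cut_off_nmem a b p m :
  ~ C m a b -> ~ cut_off b a p m -> ~ C m a p.
Proof.
move=> nmab nO map; apply: nO.
have [v [bv mv vap nvam]] := component_at_cut map.
have nvab : ~ C v a b.
  move=> vab; apply: nmab.
  exact: component_at_avoid (component_at_trans vap (component_at_sym vap)) vab nvam.
exists v; split=> //; last by move=> /component_at_sym.
have [mbv|//] := component_at_or b (nesym mv).
have [mav|vam] := component_at_or a (nesym mv); last by case: nvam.
by case: nmab; apply: component_at_trans mav (component_at_sym mbv).
Qed.

Lemma component_at_median a b p : exists m,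
  [/\ ~ C m a b, ~ C m b p, ~ C m a p & [\/ m = a, m = b, m = p | branch_point m]].
Proof.
have irr z x : ~ C z z x by move=> /component_at_sym/component_at_neq.
have irrr z x : ~ C z x z by move=> /component_at_neq.
have [abp|h] := pselect (C a b p); last by exists a; split=> //; apply: Or41.
have [bap|h] := pselect (C b a p); last by exists b; split=> //; apply: Or42.
have [pab|h] := pselect (C p a b); last by exists p; split=> //; apply: Or43.
have ab : a <> b by move=> ab; apply: (@irr a p); rewrite {2}ab.
have [z [az _] _] := branch_arc ab.
have [cA Aa Ab] := arc_connected (ex_intro _ z az).
have [m [Am nOa nOb]] : exists m,
    [/\ the_arc R a b m, ~ cut_off a b p m & ~ cut_off b a p m].
  apply: contrapT => h.
  have cov q : the_arc R a b q -> cut_off a b p q \/ cut_off b a p q.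
    move=> Aq; apply: contrapT => /not_orP[h1 h2]; apply: h; by exists q.
  have : the_arc R a b `&` cut_off a b p = the_arc R a b.
    apply: cA.
    - by exists a; split=> //; exact: cut_off_refl.
    - by exists (cut_off a b p) => //; exact: cut_off_open.
    - exists (~` cut_off b a p); first exact/open_closedC/cut_off_open.
      apply/seteqP; split=> q [Aq Oq]; split=> //; first exact: cut_off_disjoint Oq.
      by have [] := cov q Aq.
  move=> /seteqP[_ /(_ b Ab) [_ h']].
  exact: cut_off_disjoint h' (cut_off_refl bap).
have ma : m <> a by move=> e; apply: nOa; rewrite e; exact: cut_off_refl.
have mb : m <> b by move=> e; apply: nOb; rewrite e; exact: cut_off_refl.
have nmab : ~ C m a b by apply: open_arc_separates; split=> //; case.
have nmba : ~ C m b a by move=> /component_at_sym.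
have nmap := cut_off_nmem nmab nOb; have nmbp := cut_off_nmem nmba nOa.
exists m; split=> //; apply: Or44; apply/branch_pointP; exists a, b, p.
split; split=> //; [exact: nesym|exact: nesym|].
by move=> pm; apply: nmab; rewrite -pm.
Qed.

(** Two branch points [b1], [b2] are found in this order between [x] and [y]; any [z] between them
    sees [x] where it sees [b1], and [y] where it sees [b2]. *)
Lemma kaleidoscopic_separates x y i j : x <> y -> colors n i -> colors n j ->
  i <> j -> exists z,
  [/\ branch_point z, x <> z, y <> z, color_of c z x = i & color_of c z y = j].
Proof.
move=> xy ni nj ij.
have [b1 [bb1 xb1 yb1 n1]] := branch_separates xy.
have [b2 [bb2 b12 yb2 n2]] := branch_separates (nesym yb1).
have [z [zar bz ci cj]] := HK.2 _ _ _ _ bb1 bb2 b12 ni nj ij.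
have n12 := open_arc_separates zar; have [b1z b2z] := open_arc_neq zar.
have zxb : C z x b1.
  apply: component_at_away => // b1xz; apply: n1.
  have b1b2z : C b1 b2 z.
    by apply: component_at_away; [exact: nesym|move=> /component_at_sym].
  apply: component_at_trans b1xz _.
  apply: component_at_trans (component_at_sym b1b2z) _.
  apply: component_at_sym; apply: component_at_away; first exact: nesym.
  by move=> /component_at_sym.
have zyb : C z y b2.
  apply: component_at_away => // b2yz; apply: n2.
  apply: component_at_sym; apply: component_at_trans b2yz _.
  by apply: component_at_sym; apply: component_at_away => //; exact: nesym.
have xz := component_at_neq (component_at_sym zxb).
have yz := component_at_neq (component_at_sym zyb).
exists z; split=> //.
  by rewrite -ci; apply/color_component.
by rewrite -cj; apply/color_component.
Qed.

Lemma wazewski_pretree :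
  kaleidoscopic_pretree n C (@branch_point T) (color_of c).
Proof.
split.
- exact: component_at_refl.
- by move=> z x /component_at_sym/component_at_neq.
- exact: component_at_sym.
- exact: component_at_trans.
- by move=> w z x; exact: component_at_or.
- exact: component_at_median.
- exact: color_component.
- exact: color_range.
- exact: color_surj.
- exact: kaleidoscopic_separates.
Qed.

(** * Density and countability of the branch points *)

(** A connected neighborhood of [x] inside [U] has a second point, as [x] is not isolated, and
    contains every point separating the two. *)
Lemma branch_point_dense (U : set T) x : open U -> U x ->
  exists2 b, U b & branch_point b.
Proof.
move=> oU Ux; have [[_ lc _] n1 _ _] := HW.
have [V [oV Vx VU cV]] := lc x U (open_nbhs_nbhs (conj oU Ux)).
have [y Vy xy] : exists2 y, V y & x <> y.
  apply: contrapT => h; apply: (n1 x); symmetry; apply: wazewski_connected.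
  - by exists x.
  - exists V => //; rewrite setTI; apply/seteqP; split=> [_ -> //|y Vy].
    by apply: contrapT => /nesym yx; apply: h; exists y.
  - by exists [set x]; [exact: wazewski_closed1|rewrite setTI].
have [b [bb _ _ nb]] := branch_separates xy.
exists b => //; apply: VU; apply: contrapT => Vb; apply: nb.
exact: component_at_connected Vb.
Qed.

Lemma wazewski_separable : exists q : nat -> T,
  forall U : set T, open U -> U !=set0 -> exists k, U (q k).
Proof.
have [[[[t0 _] cT _ [M [f [g [fK gK fc gc]]]]] _ _] _ _ _] := HW.
pose M' : pseudoPMetricType R :=
  HB.pack_for (pseudoPMetricType R) M (isPointed.Build M (f t0)).
have cM : compact [set: M'].
  have -> : [set: M'] = f @` [set: T].
    by apply/seteqP; split=> // y _; exists (g y).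
  exact: continuous_compact (continuous_subspaceT fc) cT.
have [B /pcard_surjP[e eB] [oB bB]] := compact_second_countable cM.
(* One point from the preimage of each basic open set, or [t0] if that is empty. *)
exists (fun k => xget t0 [set t | e k (f t)]) => U oU [x Ux].
have nU : nbhs (f x : M') (g @^-1` U).
  by apply: gc; rewrite fK; exact: open_nbhs_nbhs.
have [V [BV Vx] VU] := bB (f x) _ nU.
have [k _ ek] := eB V BV.
exists k; case: xgetP => [t -> /=|/(_ x)]; rewrite ek //.
by move=> /VU; rewrite /preimage /= fK.
Qed.

(** A branch point is the unique median of three terms of a dense sequence, chosen in three of its
    components; so triples of indices, coded by [pickle], enumerate the branch points. *)
Lemma branch_point_enum : exists e : nat -> T,
  forall b, branch_point b -> exists k, e k = b.
Proof.
have [q qd] := wazewski_separable.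
pose sep (b : T) (t : nat * nat * nat) :=
  [/\ ~ C b (q t.1.1) (q t.1.2), ~ C b (q t.1.2) (q t.2) & ~ C b (q t.1.1) (q t.2)].
exists (fun k => xget (q 0%N) [set b | exists2 t, unpickle k = Some t & sep b t]).
move=> b /branch_pointP[x [y [z [[xb yb zb] [nxy nyz nxz]]]]].
have d u : u <> b -> exists k, C b u (q k).
  move=> ub; apply: qd; first exact: component_at_open.
  by exists u; exact: component_at_refl.
have [i xi] := d x xb; have [j yj] := d y yb; have [k zk] := d z zb.
have st : sep b (i, j, k).
  split=> /= h; [apply: nxy|apply: nyz|apply: nxz].
  - exact: component_at_trans xi (component_at_trans h (component_at_sym yj)).
  - exact: component_at_trans yj (component_at_trans h (component_at_sym zk)).
  - exact: component_at_trans xi (component_at_trans h (component_at_sym zk)).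
exists (pickle (i, j, k)).
case: xgetP => [b' -> [t]|/(_ b)]; rewrite pickleK; last first.
  by case; exists (i, j, k).
move=> [<-] [h1 h2 h3]; case: st => k1 k2 k3.
exact: (pretree_median_unique wazewski_pretree h1 h2 h3 k1 k2 k3).
Qed.

End Dendrite.

(** * From a correspondence of branch points to a homeomorphism *)

Section Correspondence.
Variables (R : realType) (n : option nat).

Local Open Scope classical_set_scope.

Record color_correspondence (X Y : topologicalType) (c : X -> set X -> nat)
    (d : Y -> set Y -> nat) (P : X -> Y -> Prop) : Prop := {
  corr_inj : forall x y x' y', P x y -> P x' y' -> x = x' <-> y = y';
  corr_branch : forall x y, P x y -> branch_point x <-> branch_point y;
  corr_color : forall x y x' y', P x y -> P x' y' -> branch_point x ->
    x' <> x -> color_of c x x' = color_of d y y';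
  corr_left : forall x, branch_point x -> exists y, P x y;
  corr_right : forall y, branch_point y -> exists x, P x y }.

(** Both [x = b] and [y = b'] are exempt, so that a violation persists when [x] and [y] move within
    their components; these being open, the relation is closed. *)
Definition color_compatible (X Y : topologicalType) (c : X -> set X -> nat)
    (d : Y -> set Y -> nat) (P : X -> Y -> Prop) (x : X) (y : Y) :=
  forall b b', P b b' -> branch_point b -> x <> b -> y <> b' ->
    color_of c b x = color_of d b' y.

Lemma color_correspondence_sym (X Y : topologicalType) (c : X -> set X -> nat)
    (d : Y -> set Y -> nat) (P : X -> Y -> Prop) :
  color_correspondence c d P -> color_correspondence d c (fun y x => P x y).
Proof.
move=> H; split.
- by move=> y x y' x' xy xy'; split=> /(corr_inj H xy xy').
- by move=> y x xy; split=> /(corr_branch H xy).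
- move=> y x y' x' xy xy' bY yy; rewrite (corr_color H xy xy') //.
    exact/(corr_branch H xy).
  by move=> /(corr_inj H xy' xy).
- by move=> y /(corr_right H).
- by move=> x /(corr_left H).
Qed.

Lemma color_compatible_sym (X Y : topologicalType) (c : X -> set X -> nat)
    (d : Y -> set Y -> nat) (P : X -> Y -> Prop) x y :
  color_correspondence c d P -> color_compatible c d P x y ->
  color_compatible d c (fun y x => P x y) y x.
Proof.
move=> H xy b' b bb' bY yb xb; rewrite (xy _ _ bb') //.
exact/(corr_branch H bb').
Qed.

Section OneSide.
Variables (X Y : topologicalType) (c : X -> set X -> nat) (d : Y -> set Y -> nat).
Variable P : X -> Y -> Prop.
Hypotheses (n3 : ge3 n) (WX : wazewski R n X) (WY : wazewski R n Y).
Hypotheses (KX : kaleidoscopic R n c) (KY : kaleidoscopic R n d).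
Hypothesis HP : color_correspondence c d P.

Local Notation compatible := (color_compatible c d P).

Lemma compatible_graph x y : P x y -> compatible x y.
Proof.
by move=> xy b b' bb' bb xb yb; exact: (corr_color HP bb' xy).
Qed.

(** At a branch point separating [y1] from [y2] the colors of [y1] and [y2] differ, so [x] must be
    the corresponding branch point. Two such separating points give a contradiction. *)
Lemma compatible_fun x y1 y2 : compatible x y1 -> compatible x y2 -> y1 = y2.
Proof.
move=> h1 h2; apply: contrapT => y12.
have [b1 [bb1 y1b1 y2b1 n1]] := branch_separates n3 WY KY y12.
have [b2 [bb2 y1b2 b12 n2]] := branch_separates n3 WY KY y1b1.
have n2' : ~ component_at b2 y1 y2.
  exact: (pretree_between_trans (wazewski_pretree n3 WY KY) n2 n1).
have y2b2 : y2 <> b2.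
  move=> e; rewrite e in n1; apply: n2.
  exact: (component_at_away WY b12 n1).
have sep b b' : P b b' -> branch_point b' -> y1 <> b' -> y2 <> b' ->
    ~ component_at b' y1 y2 -> x = b.
  move=> bb' bb y1b y2b nb; apply: contrapT => xb; apply: nb.
  apply/(color_component KY) => //.
  by rewrite -(h1 _ _ bb') -?(h2 _ _ bb') //; exact/(corr_branch HP bb').
have [a1 ab1] := corr_right HP bb1; have [a2 ab2] := corr_right HP bb2.
apply: b12; apply/(corr_inj HP ab1 ab2).
by rewrite -(sep _ _ ab1) // -(sep _ _ ab2).
Qed.

(** The images of branch points near [x] form a proper filter by density. A cluster point [y] exists
    by compactness, and a branch point close to [x] with image close to [y] compares their
    colors. *)
Lemma compatible_total x : exists y, compatible x y.
Proof.
pose D (U : set X) := [set b' | exists b, [/\ P b b', branch_point b & U b]].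
have FD : ProperFilter (filter_from (nbhs x) D).
  apply: filter_from_proper.
    apply: filter_from_filter; first by exists setT; exact: filterT.
    move=> U V nU nV; exists (U `&` V); first exact: filterI.
    by move=> b' [b [? ? [? ?]]]; split; exists b.
  move=> U /nbhs_interior nU.
  have [b Ub bb] := branch_point_dense n3 WX KX (open_interior U) (nbhs_singleton nU).
  have [b' bb'] := corr_left HP bb; exists b', b; split=> //.
  exact: interior_subset.
have [y [_ cy]] := wazewski_compact WY FD filterT.
exists y => b b' bb' bb xb yb'.
have [w' [[w [ww' bw bxw]] byw]] : D (component_at b x) `&` component_at b' y !=set0.
  apply: cy.
    exists (component_at b x) => //; apply: open_nbhs_nbhs; split.
      exact: (component_at_open WX).
    exact: component_at_refl.
  apply: open_nbhs_nbhs; split; first exact: (component_at_open WY).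
  exact: component_at_refl.
have wb := component_at_neq bxw; have wb' := component_at_neq byw.
rewrite ((color_component KX _ _ _).2 bxw) //.
rewrite ((color_component KY _ _ _).2 byw) //; last exact/(corr_branch HP bb').
exact: (corr_color HP bb' ww').
Qed.

(** A closed graph in a compact Hausdorff space: a cluster point of [h] at [x] is compatible with
    [x], hence equal to [h x]. *)
Lemma compatible_continuous h : (forall x, compatible x (h x)) -> continuous h.
Proof.
move=> hc x; apply: (@compact_cluster_set1 _ (h x) _ setT).
- exact: (wazewski_hausdorff WY).
- exact: (wazewski_compact WY).
- exact: filterT.
- exact: filterT.
apply/seteqP; split=> [y cy|_ ->]; last first.
  by move=> A B /nbhs_singleton Ahx /nbhs_singleton Bhx; exists (h x).
apply/esym; apply: compatible_fun (hc x) _ => b b' bb' bb xb yb'.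
have [_ [[u bxu <-] byu]] : h @` component_at b x `&` component_at b' y !=set0.
  apply: cy.
    apply: (@filterS _ _ _ (component_at b x)) => [u ?|]; first by exists u.
    apply: open_nbhs_nbhs; split; first exact: (component_at_open WX).
    exact: component_at_refl.
  apply: open_nbhs_nbhs; split; first exact: (component_at_open WY).
  exact: component_at_refl.
have ub := component_at_neq bxu; have ub' := component_at_neq byu.
rewrite ((color_component KX _ _ _).2 bxu) //.
rewrite ((color_component KY _ _ _).2 byu) //; last exact/(corr_branch HP bb').
exact: hc.
Qed.

End OneSide.

Lemma correspondence_homeomorphism (X Y : topologicalType)
    (c : X -> set X -> nat) (d : Y -> set Y -> nat) (P : X -> Y -> Prop) :
  ge3 n -> wazewski R n X -> wazewski R n Y ->
  kaleidoscopic R n c -> kaleidoscopic R n d -> color_correspondence c d P ->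
  exists h : X -> Y, [/\ homeomorphism h, preserves_colors c d h &
    forall x y, P x y -> h x = y].
Proof.
move=> n3 WX WY KX KY HP; have HP' := color_correspondence_sym HP.
have [h hc] := choice (compatible_total n3 WX WY KX KY HP).
have [g gc'] := choice (compatible_total n3 WY WX KY KX HP').
have gc y : color_compatible c d P (g y) y by exact: color_compatible_sym HP' (gc' y).
have hc' x : color_compatible d c (fun y x => P x y) (h x) x.
  exact: color_compatible_sym HP (hc x).
have gK : cancel g h.
  by move=> y; exact: (compatible_fun n3 WY KY HP (hc (g y)) (gc y)).
have hK : cancel h g.
  by move=> x; exact: (compatible_fun n3 WX KX HP' (gc' (h x)) (hc' x)).
have hP x y : P x y -> h x = y.
  by move=> xy; exact: (compatible_fun n3 WY KY HP (hc x) (compatible_graph HP xy)).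
exists h; split=> //.
  exists g; split=> //.
    exact: (compatible_continuous n3 WX WY KX KY HP hc).
  exact: (compatible_continuous n3 WY WX KY KX HP' gc').
move=> x _ bx [z zx <-].
have [y xy] := corr_left HP bx; have hxy := hP _ _ xy.
have bY : branch_point (h x) by rewrite hxy; exact/(corr_branch HP xy).
have hneq u : u <> x -> h u <> h x by move=> ux /(can_inj hK).
have col u : u <> x -> color_of d (h x) (h u) = color_of c x u.
  by move=> ux; apply/esym/hc => //; [rewrite hxy|exact: hneq].
(* Both inclusions hold because membership in a component at a branch point is read off from the
   color. *)
suff -> : h @` component_at x z = component_at (h x) (h z) by exact: col.
apply/seteqP; split=> [_ [w xzw <-]|v hv].
  have wx := component_at_neq xzw.
  apply/(color_component KY) => //; try exact: hneq.
  by rewrite !col //; apply/(color_component KX).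
have gx : g v <> x by move=> e; apply: (component_at_neq hv); rewrite -e gK.
exists (g v); last exact: gK.
apply/(color_component KX) => //; rewrite -!col // gK.
by apply/(color_component KY) => //; [exact: hneq|exact: component_at_neq hv].
Qed.

End Correspondence.

(** * Homeomorphisms extending finite partial isomorphisms *)

Section Isomorphism.
Variables (R : realType) (n : option nat) (X Y : topologicalType).
Variables (c : X -> set X -> nat) (d : Y -> set Y -> nat).
Hypotheses (n3 : ge3 n) (WX : wazewski R n X) (WY : wazewski R n Y).
Hypotheses (KX : kaleidoscopic R n c) (KY : kaleidoscopic R n d).

Local Notation piso := (partial_iso (@component_at X) (@component_at Y)
  (@branch_point X) (@branch_point Y) (color_of c) (color_of d)).

Lemma branch_point_not_end (T : topologicalType) (z : T) :
  branch_point z -> ~ pretree_end (@component_at T) z.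
Proof.
by move=> /branch_pointP[x [y [p [[xz yz _] [nxy _ _]]]]] ez; apply/nxy/ez.
Qed.

Lemma partial_iso_homeomorphism (s : seq (X * Y)) : piso s ->
  exists h : X -> Y, [/\ homeomorphism h, preserves_colors c d h &
    forall p, p \in s -> h p.1 = p.2].
Proof.
move=> Hs.
have [eX hX] := branch_point_enum n3 WX KX.
have [eY hY] := branch_point_enum n3 WY KY.
have [P [sP PP lP rP]] := back_and_forth (wazewski_pretree n3 WX KX)
  (wazewski_pretree n3 WY KY) n3 Hs hX hY.
have [|h [hh hp hP]] := @correspondence_homeomorphism R n X Y c d P n3 WX WY KX KY.
  split=> //.
  - move=> x y x' y' xy xy'; have [t [Ht xyt xyt']] := PP _ _ _ _ xy xy'.
    exact: (piso_inj Ht xyt xyt').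
  - move=> x y xy; have [t [Ht xyt _]] := PP _ _ _ _ xy xy.
    have [[]//|[/= ex ey]] := piso_type Ht xyt.
    by split=> /branch_point_not_end.
  - move=> x y x' y' xy xy' bx xx; have [t [Ht xyt xyt']] := PP _ _ _ _ xy xy'.
    have [[/= _ bY]|[/= ex _]] := piso_type Ht xyt; last first.
      by case: (branch_point_not_end bx).
    exact: (piso_col Ht xyt xyt').
by exists h; split=> // p /sP/hP.
Qed.

End Isomorphism.

Theorem theorem3p4 (R : realType) (n : option nat) (X Y : topologicalType)
    (c : X -> set X -> nat) (d : Y -> set Y -> nat) :
  ge3 n ->
  wazewski R n X -> wazewski R n Y ->
  kaleidoscopic R n c -> kaleidoscopic R n d ->
  (exists h : X -> Y, homeomorphism h /\ preserves_colors c d h) /\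
  (forall (e0 e1 : X) (f0 f1 : Y) (x : X) (y : Y),
    e0 <> e1 -> end_point e0 -> end_point e1 ->
    f0 <> f1 -> end_point f0 -> end_point f1 ->
    the_arc R e0 e1 x -> branch_point x ->
    the_arc R f0 f1 y -> branch_point y ->
    color_of c x e0 = color_of d y f0 ->
    color_of c x e1 = color_of d y f1 ->
    exists h : X -> Y,
      [/\ homeomorphism h, preserves_colors c d h,
          h e0 = f0, h e1 = f1 & h x = y]).
Proof.
move=> n3 WX WY KX KY.
have irr (T : topologicalType) (z t : T) : ~ component_at z z t.
  by move=> /component_at_sym/component_at_neq.
have irrr (T : topologicalType) (z t : T) : ~ component_at z t z.
  by move=> /component_at_neq.
split.
  have exb (T : topologicalType) (k : T -> set T -> nat) :
      wazewski R n T -> kaleidoscopic R n k -> exists b : T, branch_point b.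
    move=> W K; have [[[[t _]]]] := W.
    have [b _ bb] := branch_point_dense n3 W K openT (I : [set: T]%classic t).
    by exists b.
  have [x bx] := exb X c WX KX; have [y bY] := exb Y d WY KY.
  (* A single pair of branch points is a partial isomorphism. *)
  have [|h [hh hp _]] := @partial_iso_homeomorphism R n X Y c d n3 WX WY KX KY [:: (x, y)].
    split.
    - by move=> p q; rewrite !inE => /eqP-> /eqP->.
    - by move=> p; rewrite inE => /eqP->; left.
    - by move=> p q; rewrite !inE => /eqP-> /eqP->.
    - move=> p q r; rewrite !inE => /eqP-> /eqP-> /eqP->; exists x.
        by exists (x, y) => //; rewrite inE.
      by split; exact: irr.
    - by exists (x, y); rewrite ?inE.
  by exists h.
move=> e0 e1 f0 f1 x y e01 ee0 ee1 f01 ef0 ef1 xe bx yf bY c0 c1.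
have pend (T : topologicalType) (z : T) : end_point z -> pretree_end (@component_at T) z.
  by move=> ez u v; exact: end_point_component.
have bend (T : topologicalType) (z b : T) : end_point z -> branch_point b -> z <> b.
  by move=> /pend ez bb zb; apply: (branch_point_not_end bb); rewrite -zb.
have [e0x e1x] := (bend _ _ _ ee0 bx, bend _ _ _ ee1 bx).
have [f0y f1y] := (bend _ _ _ ef0 bY, bend _ _ _ ef1 bY).
have ne01 : ~ component_at x e0 e1.
  apply: (open_arc_separates n3 WX KX); split=> //.
  by case=> /esym.
have ne10 : ~ component_at x e1 e0 by move=> /component_at_sym.
have nb0 : ~ branch_point e0 by move=> /(bend _ _ _ ee0).
have nb1 : ~ branch_point e1 by move=> /(bend _ _ _ ee1).
(* As [x] separates [e0] from [e1], these three points are closed under medians; colors are compared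
   only at [x], where they agree by [c0] and [c1]. *)
have [|h [hh hp hs]] := @partial_iso_homeomorphism R n X Y c d n3 WX WY KX KY
    [:: (e0, f0); (e1, f1); (x, y)].
  split.
  - move=> p q; rewrite !inE => /or3P[]/eqP-> /or3P[]/eqP-> /=; split=> // /esym //.
  - move=> p; rewrite !inE => /or3P[]/eqP-> /=; [right|right|by left]; split; exact: pend.
  - by move=> p q; rewrite !inE => /or3P[]/eqP-> /or3P[]/eqP-> /=.
  - move=> p q r; rewrite !inE.
    have h0 : dom [:: (e0, f0); (e1, f1); (x, y)] e0.
      by exists (e0, f0) => //; rewrite !inE eqxx.
    have h1 : dom [:: (e0, f0); (e1, f1); (x, y)] e1.
      by exists (e1, f1) => //; rewrite !inE eqxx orbT.
    have h2 : dom [:: (e0, f0); (e1, f1); (x, y)] x.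
      by exists (x, y) => //; rewrite !inE eqxx !orbT.
    by move=> /or3P[]/eqP-> /or3P[]/eqP-> /or3P[]/eqP-> /=;
      solve [exists e0 => //; split; auto | exists e1 => //; split; auto |
             exists x => //; split; auto].
  - by exists (x, y); rewrite ?inE ?eqxx ?orbT.
exists h; split=> //.
- by apply: (hs (e0, f0)); rewrite !inE eqxx.
- by apply: (hs (e1, f1)); rewrite !inE eqxx orbT.
- by apply: (hs (x, y)); rewrite !inE eqxx !orbT.
Qed.
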